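(* Let $\alpha\in[1/2,2]$, $\beta\in\mathbb{R}$, and let $(p_{i,j})_{-1\le i,j\le 1}$ be the jump probabilities of a random walk in the class $\mathscr{P}_{\alpha,\beta}$. Let $C>0$ be the constant, depending only on $(p_{i,j})_{i,j}$, such that for all integers $i_0,j_0\ge1$ and all $\gamma\in[0,\pi/2]$, $G_{i,j}^{i_0,j_0}\sim C\,i_0j_0(i_0+\alpha j_0+\beta)\,ij(i+\alpha j)/[i^2+\alpha ij+\alpha^2j^2]^3$ as $i+j\to\infty$ and $j/i\to\tan(\gamma)$. Then for all integers $i_0,j_0\ge1$, as $i\to\infty$, $$h_i^{i_0,j_0}\sim C\,(p_{1,-1}+p_{0,-1}+p_{-1,-1})\,i_0j_0\,(i_0+\alpha j_0+\beta)\,\frac1{i^4},$$ $$\widetilde h_i^{i_0,j_0}\sim C\,\frac{p_{-1,1}+p_{-1,0}+p_{-1,-1}}{\alpha^5}\,i_0j_0\,(i_0+\alpha j_0+\beta)\,\frac1{i^4}.$$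
   Context: The class $\mathscr{P}$ consists of the random walks $(X(k),Y(k))_{k\ge0}$ in the quarter plane $\mathbb{Z}_+^2$ which, from each interior point $(i,j)$ with $i,j\ge1$, jump to $(i+r,j+s)$ with probability $p_{r,s}$, $-1\le r,s\le1$, where $p_{r,s}\ge0$ (some may vanish), $p_{0,0}=0$, $\sum_{r,s}p_{r,s}=1$; which have zero drift, i.e. $p_{1,1}+p_{1,0}+p_{1,-1}=p_{-1,1}+p_{-1,0}+p_{-1,-1}$ and $p_{1,1}+p_{0,1}+p_{-1,1}=p_{1,-1}+p_{0,-1}+p_{-1,-1}$; and which are killed (absorbed) on first reaching the boundary $\{i=0\}\cup\{j=0\}$. Put $a(x)=p_{1,1}x^2+p_{0,1}x+p_{-1,1}$, $b(x)=p_{1,0}x^2-x+p_{-1,0}$, $c(x)=p_{1,-1}x^2+p_{0,-1}x+p_{-1,-1}$, $d=b^2-4ac$, and $\tilde a(y)=p_{1,1}y^2+p_{1,0}y+p_{1,-1}$, $\tilde b(y)=p_{0,1}y^2-y+p_{0,-1}$, $\tilde c(y)=p_{-1,1}y^2+p_{-1,0}y+p_{-1,-1}$, $\tilde d=\tilde b^2-4\tilde a\tilde c$. Standing assumption for walks in $\mathscr{P}$: each of $d$ and $\tilde d$ has exactly one simple root in $]-1,1[$, a double root at $1$, and one simple root in $(\mathbb{R}\cup\{\infty\})\setminus[-1,1]$ (the root is $\infty$ when the polynomial has degree $3$). $\mathscr{P}_{\alpha,\beta}$ is the set of walks of $\mathscr{P}$ for which $h(i_0,j_0)=i_0j_0(i_0+\alpha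 j_0+\beta)$ is harmonic, i.e. $h(i_0,j_0)=\sum_{r,s}p_{r,s}h(i_0+r,j_0+s)$ for all integers $i_0,j_0\ge1$. The Green functions are, for integers $i,j,i_0,j_0\ge1$, $G_{i,j}^{i_0,j_0}=\mathbb{E}_{(i_0,j_0)}\big[\sum_{k\ge0}\mathbf{1}_{\{(X(k),Y(k))=(i,j)\}}\big]$. The absorption probabilities are, for $i,j\ge1$, $h_i^{i_0,j_0}=\mathbb{P}_{(i_0,j_0)}[\exists k\ge1:(X(k),Y(k))=(i,0)]$ and $\widetilde h_j^{i_0,j_0}=\mathbb{P}_{(i_0,j_0)}[\exists k\ge1:(X(k),Y(k))=(0,j)]$, for the walk stopped when it first reaches the boundary. Here $\mathbb{P}_{(i_0,j_0)}$, $\mathbb{E}_{(i_0,j_0)}$ are conditional on $(X(0),Y(0))=(i_0,j_0)$, and $a_n\sim b_n$ means $a_n/b_n\to1$. It is part of the setting that a constant $C$ as described in the claim exists (for $\gamma=\pi/2$, $j/i\to\tan(\gamma)$ means $j/i\to\infty$). *)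

(* Defs.v *)
From HB Require Import structures.
From mathcomp Require Import all_boot all_order all_algebra.
From mathcomp Require Import all_classical all_reals all_analysis.
Set Implicit Arguments.
Unset Strict Implicit.
Unset Printing Implicit Defensive.
Import Order.TTheory GRing.Theory Num.Theory.
Import numFieldNormedType.Exports.
Local Open Scope classical_set_scope.
Local Open Scope ring_scope.

Definition steps : seq int := [:: -1; 0; 1].

Section Kernel.
Context {R : realType}.
Implicit Types (p : int -> int -> R) (D : {poly R}) (x : option R).

Definition poly2 (u v w : R) : {poly R} := u *: 'X^2 + v *: 'X + w%:P.

Definition ker_a p := poly2 (p 1 1) (p 0 1) (p (-1) 1).
Definition ker_b p := poly2 (p 1 0) (-1) (p (-1) 0).
Definition ker_c p := poly2 (p 1 (-1)) (p 0 (-1)) (p (-1) (-1)).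
Definition ker_d p := ker_b p ^+ 2 - 4 *: (ker_a p * ker_c p).

(* A prime stands for the tilde. *)
Definition ker_a' p := poly2 (p 1 1) (p 1 0) (p 1 (-1)).
Definition ker_b' p := poly2 (p 0 1) (-1) (p 0 (-1)).
Definition ker_c' p := poly2 (p (-1) 1) (p (-1) 0) (p (-1) (-1)).
Definition ker_d' p := ker_b' p ^+ 2 - 4 *: (ker_a' p * ker_c' p).

(* Multiplicity of a point of R u {oo} as a root of D seen as a quartic form;
   [None] is the point at infinity, a simple root exactly when deg D = 3
   (and [size D] is deg D + 1). *)
Definition root_mult D x : nat :=
  if x is Some t then mup t D else (5 - size D)%N.

Definition outside x : Prop := if x is Some t then ~~ (-1 <= t <= 1) else True.

Definition root_condition D : Prop :=
  [/\ exists! t : R, -1 < t < 1 /\ mup t D = 1%N,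
      mup 1 D = 2%N
    & exists! x : option R, outside x /\ root_mult D x = 1%N].

(* The jump probabilities are extended by 0 to a function on Z^2. *)
Record classP p : Prop := ClassP {
  jump_supp : forall r s, ~~ ((r \in steps) && (s \in steps)) -> p r s = 0;
  jump_ge0 : forall r s, 0 <= p r s;
  jump_00 : p 0 0 = 0;
  jump_sum : \sum_(r <- steps) \sum_(s <- steps) p r s = 1;
  drift_x : p 1 1 + p 1 0 + p 1 (-1) = p (-1) 1 + p (-1) 0 + p (-1) (-1);
  drift_y : p 1 1 + p 0 1 + p (-1) 1 = p 1 (-1) + p 0 (-1) + p (-1) (-1);
  roots_d : root_condition (ker_d p);
  roots_d' : root_condition (ker_d' p) }.

Definition harm (alpha beta x y : R) : R := x * y * (x + alpha * y + beta).

Definition is_harmonic p (h : R -> R -> R) : Prop :=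
  forall i0 j0 : nat, (1 <= i0)%N -> (1 <= j0)%N ->
    h i0%:R j0%:R = \sum_(r <- steps) \sum_(s <- steps)
      p r s * h (i0%:R + r%:~R) (j0%:R + s%:~R).

Definition classPab p (alpha beta : R) : Prop :=
  classP p /\ is_harmonic p (harm alpha beta).

(* Boundary points are absorbing: the chain is stopped there, not sent to a
   cemetery. *)
Definition absorbing_kernel p (z z' : nat * nat) : R :=
  if (0 < z.1)%N && (0 < z.2)%N
  then p (z'.1%:Z - z.1%:Z) (z'.2%:Z - z.2%:Z)
  else (z' == z)%:R.

End Kernel.

Section Walk.
Context {R : realType} {d : measure_display} {Omega : measurableType d}.
Implicit Types (P : nat -> nat -> probability Omega R)
  (X Y : nat -> {mfun Omega >-> nat}).

Definition history X Y (n : nat) (z : nat -> nat * nat) : set Omega :=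
  [set w | forall k, (k <= n)%N -> (X k w, Y k w) = z k].

(* Under [P i0 j0], (X, Y) is the Markov chain started at (i0, j0) with
   transition matrix [absorbing_kernel p]; the Markov property
   P(W_{n+1} = z_{n+1} | W_0 = z_0, ..., W_n = z_n) = absorbing_kernel p z_n z_{n+1}
   is written multiplicatively, to cover null histories. *)
Definition absorbed_walk (p : int -> int -> R) P X Y : Prop :=
  forall i0 j0 : nat, (1 <= i0)%N -> (1 <= j0)%N ->
    P i0 j0 [set w | (X 0%N w, Y 0%N w) = (i0, j0)] = 1%:E /\
    forall (n : nat) (z : nat -> nat * nat),
      P i0 j0 (history X Y n.+1 z) =
      (P i0 j0 (history X Y n z) * (absorbing_kernel p (z n) (z n.+1))%:E)%E.

Definition green P X Y (i0 j0 i j : nat) : \bar R :=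
  (\int[P i0 j0]_w \sum_(0 <= k <oo)
     (\1_[set w' | (X k w', Y k w') = (i, j)] w)%:E)%E.

Definition absorb_x P X Y (i0 j0 i : nat) : \bar R :=
  P i0 j0 [set w | exists2 k : nat, (1 <= k)%N & (X k w, Y k w) = (i, 0%N)].

Definition absorb_y P X Y (i0 j0 j : nat) : \bar R :=
  P i0 j0 [set w | exists2 k : nat, (1 <= k)%N & (X k w, Y k w) = (0%N, j)].

End Walk.

Section Asymptotics.
Context {R : realType}.

(* u_n / v_n --> 1, in the extended reals; u_n may a priori be infinite. *)
Definition asymp_equiv (u : nat -> \bar R) (v : nat -> R) : Prop :=
  (u n * ((v n)^-1)%:E)%E @[n --> \oo] --> 1%:E.

Definition tan_bar (gamma : R) : \bar R :=
  if gamma == pi / 2 then +oo%E else (tan gamma)%:E.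

(* i + j --> oo and j / i --> tan gamma, through pairs of positive integers. *)
Definition to_infinity_along (gamma : R) (i j : nat -> nat) : Prop :=
  [/\ forall n, (1 <= i n)%N /\ (1 <= j n)%N,
      (i n + j n)%N @[n --> \oo] --> \oo
    & ((j n)%:R / (i n)%:R : R)%:E @[n --> \oo] --> tan_bar gamma].

Definition green_constant {d} {Omega : measurableType d}
    (P : nat -> nat -> probability Omega R)
    (X Y : nat -> {mfun Omega >-> nat}) (alpha beta C : R) : Prop :=
  forall i0 j0 : nat, (1 <= i0)%N -> (1 <= j0)%N ->
  forall gamma : R, 0 <= gamma <= pi / 2 ->
  forall i j : nat -> nat, to_infinity_along gamma i j ->
    asymp_equiv (fun n => green P X Y i0 j0 (i n) (j n))
      (fun n => let x := (i n)%:R in let y := (j n)%:R in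
         C * harm alpha beta i0%:R j0%:R * (x * y * (x + alpha * y))
         / (x ^+ 2 + alpha * x * y + alpha ^+ 2 * y ^+ 2) ^+ 3).

End Asymptotics.

(* Main.v *)
Require Import Defs.
From HB Require Import structures.
From mathcomp Require Import all_boot all_order all_algebra.
From mathcomp Require Import all_classical all_reals all_analysis.
From mathcomp Require Import measurable_realfun.
From mathcomp Require Import ring lra zify.
Import Order.TTheory GRing.Theory Num.Theory.
Import numFieldNormedType.Exports.
Local Open Scope classical_set_scope.
Local Open Scope ring_scope.

(* The walk is absorbed at (i, 0) exactly when it makes a last jump from one of
   (i - 1, 1), (i, 1), (i + 1, 1), so that
   h_i = p_{1,-1} G_{i-1,1} + p_{0,-1} G_{i,1} + p_{-1,-1} G_{i+1,1};
   likewise on the other axis. The Green functions on the right are covered by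
   the hypothesis with gamma = 0 (resp. gamma = pi / 2), where the rational
   function is equivalent to 1 / i^4 (resp. 1 / (alpha^5 i^4)). *)

(** * Splitting a measure along the fibres of a map into a countable type *)

(** The fibres cut [A] into countably many disjoint pieces, enumerated by [pickle] codes; an integer
    that codes nothing contributes 0. *)
Lemma measure_fiber_series {R : realType} {d : measure_display}
    {Omega : measurableType d} {T : countType}
    (mu : {measure set Omega -> \bar R}) (g : Omega -> T)
    (mg : forall v, measurable (g @^-1` [set v])) (A : set Omega) :
  measurable A ->
  mu A = (\sum_(0 <= i <oo)
    oapp (fun v => mu (A `&` g @^-1` [set v])) 0 (pickle_inv i))%E.
Proof.
move=> mA.
pose F i := if @pickle_inv T i is Some v then A `&` g @^-1` [set v] else set0.
have AE : A = \bigcup_i F i.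
  apply/seteqP; split=> [w Aw|w [i _]].
    by exists (pickle (g w)) => //; rewrite /F pickleK_inv.
  by rewrite /F; case: pickle_inv => // v [].
have mF i : measurable (F i).
  by rewrite /F; case: pickle_inv => // v; exact: measurableI.
rewrite {1}AE measure_semi_bigcup //; last 2 first.
- apply/trivIsetP => i j _ _ /eqP ij; rewrite -classical_sets.subset0 => w [].
  rewrite /F; case Ei: (pickle_inv i) => [v|//] [_ /= gv].
  case Ej: (pickle_inv j) => [v'|//] [_ /= gv']; apply: ij.
  have := @pickle_invK T i; have := @pickle_invK T j.
  by rewrite Ei Ej /= -gv -gv' => <- <-.
- exact: bigcup_measurable.
by apply: eq_eseriesr => i _; rewrite /F; case: pickle_inv => //=.
Qed.

(** The fibres over [s] are removed from [A] one at a time, and what is left at the end is null. *)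
Lemma measure_fiber_sum {R : realType} {d : measure_display}
    {Omega : measurableType d} {T : countType}
    (mu : {measure set Omega -> \bar R}) (g : Omega -> T)
    (mg : forall v, measurable (g @^-1` [set v])) (s : seq T) (A : set Omega) :
  measurable A -> uniq s ->
  (forall v, v \notin s -> mu (A `&` g @^-1` [set v]) = 0)%E ->
  mu A = (\sum_(v <- s) mu (A `&` g @^-1` [set v]))%E.
Proof.
elim: s A => [|c s IH] A mA /=.
  move=> _ A0; rewrite big_nil (@measure_fiber_series _ _ _ _ mu g)//.
  by rewrite eseries0// => i _ _; case: pickle_inv => //= v; exact: A0.
move=> /andP[cs us] A0; rewrite big_cons addeC.
have mC : measurable (g @^-1` [set c]) by [].
have -> : mu A = (mu (A `\` g @^-1` [set c]) + mu (A `&` g @^-1` [set c]))%E.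
  exact: measureDI.
congr (_ + _)%E.
rewrite (IH (A `\` g @^-1` [set c])) //; last 2 first.
- exact: measurableD.
- move=> v vs; have [->|vc] := eqVneq v c.
    by rewrite setDE -setIA setICl setI0 measure0.
  apply: (subset_measure0 (B := A `&` g @^-1` [set v])).
  + by apply: measurableI => //; exact: measurableD.
  + exact: measurableI.
  + by move=> w [[]].
  + by apply: A0; rewrite inE negb_or vc.
(* The remaining fibres do not meet the removed one, because [c] is not in [s]. *)
rewrite !big_seq; apply: eq_bigr => v vs; congr (mu _).
apply/seteqP; split=> [w [[]]//|w [Aw gv]]; split=> //; split=> //= gc.
by move: gv cs; rewrite /= gc => ->; rewrite vs.
Qed.

(** * Absorption of a Markov chain with countably many states *)

Section MarkovChain.
Context {R : realType} {d : measure_display} {Omega : measurableType d}.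
Context {T : countType} (P : probability Omega R) (Z : nat -> Omega -> T).
Variables (K : T -> T -> R) (z0 : T).
Hypothesis mZ : forall n v, measurable (Z n @^-1` [set v]).
Hypothesis Z0 : P (Z 0%N @^-1` [set z0]) = 1%E.

(** The starting time [m] varies so that the past can be forgotten one instant at a time. *)
Let window m n (z : nat -> T) : set Omega :=
  [set w | forall k, (m <= k <= n)%N -> Z k w = z k].

Hypothesis markov : forall n z,
  P (window 0 n.+1 z) = (P (window 0 n z) * (K (z n) (z n.+1))%:E)%E.

Let measurable_window m n z : measurable (window m n z).
Proof.
have -> : window m n z =
    \bigcap_(k in [set k | (m <= k <= n)%N]) Z k @^-1` [set z k] by [].
by apply: bigcap_measurableType => k _; exact: mZ.
Qed.

Let windowS m n z v : (m <= n)%N ->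
  window m.+1 n z `&` Z m @^-1` [set v] = window m n [eta z with m |-> v].
Proof.
move=> mn; apply/seteqP; split=> w => [[Hw Zv] k /andP[mk kn]|Hw] /=.
  case: eqVneq => [->//|km]; apply: Hw; lia.
split; last by have /= := Hw m; rewrite eqxx; apply; lia.
by move=> k mk; have /= := Hw k; case: eqVneq => [km|_]; [lia|apply; lia].
Qed.

(** Induction on [m]: splitting by the value at time [m] extends the window into the past, where the
    case [m] applies. In the inductive step [m < n], so the transition factor does not depend on
    that value and leaves the series. *)
Let markov_window m n z : (m <= n)%N ->
  P (window m n.+1 z) = (P (window m n z) * (K (z n) (z n.+1))%:E)%E.
Proof.
elim: m z => [z _|m IH z mn]; first exact: markov.
have mg := mZ m.
rewrite (@measure_fiber_series _ _ _ _ P _ mg (window _ _ _)) //.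
rewrite (@measure_fiber_series _ _ _ _ P _ mg (window m.+1 n z)) //.
rewrite muleC -nneseriesZl; last by move=> i _; case: pickle_inv => /=.
apply: eq_eseriesr => i _; case: pickle_inv => [v|]/=; last by rewrite mule0.
rewrite !windowS ?IH 1?muleC//; try lia.
by rewrite /= !ifN//; apply/eqP; lia.
Qed.

Lemma markov_step n u v :
  P (Z n.+1 @^-1` [set v] `&` Z n @^-1` [set u]) =
  (P (Z n @^-1` [set u]) * (K u v)%:E)%E.
Proof.
(* Only the values of this path at times [n] and [n.+1] matter. *)
pose z k := if k == n then u else v.
have zn : z n = u by rewrite /z eqxx.
have zn1 : z n.+1 = v by rewrite /z ifN//; apply/eqP; lia.
have -> : Z n @^-1` [set u] = window n n z.
  apply/seteqP; split=> w /= => [Zu k kn|Hw]; last by rewrite Hw//; lia.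
  by have -> : k = n by [lia]; rewrite zn.
rewrite -zn -{2}zn1 -markov_window//; congr (P _).
apply/seteqP; split=> w /= => [[Zv Hw] k kn|Hw].
  have [kn1|->] : (n <= k <= n)%N \/ k = n.+1 by lia.
    exact: Hw.
  by rewrite Zv.
split; first by rewrite Hw ?zn1//; lia.
by move=> k kn; apply: Hw; lia.
Qed.

Section Absorption.
Variables (b : T) (s : seq T).
Hypothesis K_ge0 : forall v, 0 <= K v b.
Hypotheses (Kbb : K b b = 1) (us : uniq s) (bs : b \notin s) (z0b : z0 != b).
Hypothesis K0 : forall v, v != b -> v \notin s -> K v b = 0.

Let F n := Z n @^-1` [set b].
Let U n : set Omega := [set w | exists2 k, (1 <= k <= n)%N & Z k w = b].

Let mF n : measurable (F n). Proof. exact: mZ. Qed.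

Let mU n : measurable (U n).
Proof.
have -> : U n = \bigcup_(k in [set k | (1 <= k <= n)%N]) F k by [].
by apply: bigcup_measurable => k _.
Qed.

Let PF0 : P (F 0) = 0%E.
Proof.
apply: (@subset_measure0 _ _ _ P _ (~` (Z 0%N @^-1` [set z0]))) => //.
- exact: measurableC.
- by move=> w /= -> zb; case/eqP: z0b.
- by transitivity (1 - P (Z 0%N @^-1` [set z0]))%E;
    [exact: probability_setC|rewrite Z0 subee].
Qed.

(** The probability of entering [b] at time [n.+1] from a state of [s]. *)
Let y n := (\sum_(v <- s) P (Z n @^-1` [set v]) * (K v b)%:E)%E.

(** Split by the state at time [n]: from [b] the chain stays almost surely, and a state outside
    [b :: s] cannot jump to [b]. *)
Let PFS n : P (F n.+1) = (P (F n) + y n)%E.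
Proof.
rewrite (@measure_fiber_sum _ _ _ _ P _ (mZ n) (b :: s))//=; last 2 first.
- by rewrite bs us.
- move=> v; rewrite inE negb_or => /andP[vb vs].
  by rewrite markov_step K0// mule0.
rewrite big_cons markov_step Kbb mule1; congr (_ + _)%E.
by apply: eq_bigr => v _; rewrite markov_step.
Qed.

Let PF n : P (F n) = (\sum_(0 <= k < n) y k)%E.
Proof.
elim: n => [|n IH]; first by rewrite big_geq.
by rewrite big_nat_recr//= PFS IH.
Qed.

(* As b is absorbing, having visited b by time n is, up to a null set, the same
   as being at b at time n. *)
Let PUF n : P (U n `\` F n) = 0%E.
Proof.
elim: n => [|n IH].
  suff -> : U 0%N `\` F 0%N = set0 by rewrite measure0.
  by rewrite -classical_sets.subset0 => w [[k]]; lia.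
(* A path that met [b] by time [n.+1] but is elsewhere at that time was either already away from [b]
   at time [n] after a visit, or leaves [b] in the last step. Both events are null. *)
apply: (@subset_measure0 _ _ _ P _ ((U n `\` F n) `|` (F n `\` F n.+1))).
- exact: measurableD.
- by apply: measurableU; exact: measurableD.
- move=> w [[k kn Zk] nF]; have [Fn|nFn] := pselect (F n w); [by right|left].
  split=> //; exists k => //; suff : k != n.+1 by lia.
  by apply/eqP => kn1; apply: nF; rewrite /F /= -kn1.
- have FF0 : P (F n `\` F n.+1) = 0%E.
    transitivity (P (F n) - P (F n `&` F n.+1))%E.
      by apply: measureD => //; rewrite ltey_eq fin_num_measure.
    by rewrite setIC markov_step Kbb mule1 subee// fin_num_measure.
  transitivity (P (U n `\` F n)); last exact: IH.
  by apply: measureU0 => //; exact: measurableD.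
Qed.

Let PU n : P (U n) = P (F n).
Proof.
have -> : P (U n) = (P (U n `\` F n) + P (U n `&` F n))%E.
  exact: measureDI.
(* For [n = 0] no visiting time is allowed and the start is not [b], so both sides vanish. *)
rewrite PUF add0e; case: n => [|n].
  rewrite PF0 (_ : _ `&` _ = set0) ?measure0//.
  by rewrite -classical_sets.subset0 => w [[k]]; lia.
congr (P _); apply/seteqP; split=> [w []//|w Fw]; split=> //.
by exists n.+1 => //; lia.
Qed.

(** The events [U n] increase to the event on the left, and [P (U n) = P (F n)] is a partial sum of
    the series of [y]. Exchanging this series with the sum over [s] produces the expected numbers of
    visits. *)
Lemma absorption_green :
  P [set w | exists2 k, (1 <= k)%N & Z k w = b] =
  (\sum_(v <- s) (K v b)%:E * \sum_(0 <= k <oo) P (Z k @^-1` [set v]))%E.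
Proof.
have PU_lim : P \o U @ \oo --> P (\bigcup_n U n).
  apply: nondecreasing_cvg_mu => //; first exact: bigcup_measurable.
  move=> m n mn; apply/subsetPset => w [k km Zk].
  by exists k => //; lia.
have -> : [set w | exists2 k, (1 <= k)%N & Z k w = b] = \bigcup_n U n.
  apply/seteqP; split=> w /= => [[k k1 Zk]|[n _ [k kn Zk]]].
    by exists k => //; exists k => //; lia.
  by exists k => //; lia.
rewrite -(cvg_lim _ PU_lim)//.
transitivity (\sum_(0 <= k <oo) y k)%E.
  rewrite (_ : P \o U = (fun n => \sum_(0 <= k < n) y k)%E)//.
  by apply/funext => n; rewrite /= PU PF.
rewrite nneseries_sum; last by move=> v n _; rewrite mule_ge0// lee_fin.
apply: eq_bigr => v _; rewrite -nneseriesZl//.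
by apply: eq_eseriesr => n _; rewrite muleC.
Qed.

End Absorption.
End MarkovChain.

(** * Positivity of the jump weights towards the axes *)

(** Multiplicities in a nonzero square are even, whereas the condition demands a simple root. *)
Lemma root_condition_sqr {R : realType} (D : {poly R}) :
  D != 0 -> ~ root_condition (D ^+ 2).
Proof. by move=> D0 [[t [[_ +] _]] _ _]; rewrite expr2 mupM//; lia. Qed.

Lemma poly2_neq0 {R : realType} (u w : R) : poly2 u (-1) w != 0.
Proof.
apply/eqP => /polyP/(_ 1%N); rewrite /poly2 !coefE/=.
by move/eqP; rewrite mulr0 mulr1 add0r addr0 oppr_eq0 oner_eq0.
Qed.

Lemma poly2_0 {R : realType} : poly2 0 0 0 = 0 :> {poly R}.
Proof. by rewrite /poly2 !scale0r !add0r. Qed.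

(* Otherwise c = 0 and d = b^2 has no simple root. *)
Lemma down_gt0 {R : realType} (p : int -> int -> R) : classP p ->
  0 < p 1 (-1) + p 0 (-1) + p (-1) (-1).
Proof.
move=> [_ p0 _ _ _ _ rd _].
have := p0 1 (-1); have := p0 0 (-1); have := p0 (-1) (-1) => h1 h2 h3.
rewrite lt_neqAle !addr_ge0// andbT eq_sym; apply/eqP => e.
apply: (@root_condition_sqr _ (ker_b p)); first exact: poly2_neq0.
suff c0 : ker_c p = 0 by move: rd; rewrite /ker_d c0 mulr0 scaler0 subr0.
have [z1 z2 z3] : [/\ p 1 (-1) = 0, p 0 (-1) = 0 & p (-1) (-1) = 0].
  by split; lra.
by rewrite /ker_c z1 z2 z3 poly2_0.
Qed.

(** Mirror image: otherwise [ker_c' p] vanishes and [ker_d' p] is the square of [ker_b' p]. *)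
Lemma left_gt0 {R : realType} (p : int -> int -> R) : classP p ->
  0 < p (-1) 1 + p (-1) 0 + p (-1) (-1).
Proof.
move=> [_ p0 _ _ _ _ _ rd].
have := p0 (-1) 1; have := p0 (-1) 0; have := p0 (-1) (-1) => h1 h2 h3.
rewrite lt_neqAle !addr_ge0// andbT eq_sym; apply/eqP => e.
apply: (@root_condition_sqr _ (ker_b' p)); first exact: poly2_neq0.
suff c0 : ker_c' p = 0 by move: rd; rewrite /ker_d' c0 mulr0 scaler0 subr0.
have [z1 z2 z3] : [/\ p (-1) 1 = 0, p (-1) 0 = 0 & p (-1) (-1) = 0].
  by split; lra.
by rewrite /ker_c' z1 z2 z3 poly2_0.
Qed.

(** * The rational function near the two axes *)

Definition green_shape {R : realType} (al x y : R) : R :=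
  x * y * (x + al * y) / (x ^+ 2 + al * x * y + al ^+ 2 * y ^+ 2) ^+ 3.

Lemma cvg_inv_natD {R : realType} (k : nat) : (0 < k)%N ->
  ((n + k)%:R : R)^-1 @[n --> \oo] --> (0 : R).
Proof.
case: k => // k _; have := @cvg_harmonic R; rewrite -(cvg_shiftn k) /=.
by under eq_fun do rewrite -addnS.
Qed.

Lemma cvg_ratio_natD {R : realType} (k l : nat) : (0 < l)%N ->
  ((n + k)%:R / (n + l)%:R : R) @[n --> \oo] --> (1 : R).
Proof.
move=> l0.
have -> : (fun n => (n + k)%:R / (n + l)%:R : R) =
    (fun n => 1 + (k%:R - l%:R) * (n + l)%:R^-1).
  apply/funext => n; have : (n + l)%:R != 0 :> R by rewrite pnatr_eq0; lia.
  by rewrite !natrD => nl; field.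
rewrite -[X in _ --> X]addr0 -(mulr0 (k%:R - l%:R)).
by apply: cvgD; [exact: cvg_cst|apply: cvgMl_tmp; exact: cvg_inv_natD].
Qed.

Lemma green_shape_gt0 {R : realType} (al x y : R) :
  0 < al -> 0 < x -> 0 < y -> 0 < green_shape al x y.
Proof.
move=> al0 x0 y0; rewrite /green_shape divr_gt0 ?exprn_gt0//.
  by rewrite !(mulr_gt0, addr_gt0).
by rewrite !(mulr_gt0, addr_gt0, exprn_gt0).
Qed.

(** Homogeneity of degree 3 - 6 = -3. *)
Lemma green_shapeZ {R : realType} (al t x y : R) :
  t != 0 -> green_shape al (t * x) (t * y) = green_shape al x y / t ^+ 3.
Proof.
move=> t0; rewrite /green_shape.
set q := x ^+ 2 + al * x * y + al ^+ 2 * y ^+ 2.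
have -> : (t * x) ^+ 2 + al * (t * x) * (t * y) + al ^+ 2 * (t * y) ^+ 2 =
  t ^+ 2 * q by rewrite /q; ring.
(* The inverse of [q ^+ 3] is made opaque, so that [field] does not ask for [q != 0]. *)
rewrite exprMn invfM; move: (q ^+ 3)^-1 => u.
by field.
Qed.

Lemma cvg_expX {R : realType} (u : nat -> R) (l : R) k :
  u n @[n --> \oo] --> l -> u n ^+ k @[n --> \oo] --> l ^+ k.
Proof.
by move=> ul; apply: (@cvg_comp _ _ _ u (fun x => x ^+ k) _ _ _ ul);
  exact: exprn_continuous.
Qed.

(** The factor [y] of [green_shape] is left out: after rescaling it tends to 0 near the first axis
    and would make the limit 0. *)
Lemma cvg_green_form {R : realType} (al : R) (x y : nat -> R) (a b : R) :
  x n @[n --> \oo] --> a -> y n @[n --> \oo] --> b ->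
  a ^+ 2 + al * a * b + al ^+ 2 * b ^+ 2 != 0 ->
  (x n * (x n + al * y n) /
    (x n ^+ 2 + al * x n * y n + al ^+ 2 * y n ^+ 2) ^+ 3) @[n --> \oo] -->
  a * (a + al * b) / (a ^+ 2 + al * a * b + al ^+ 2 * b ^+ 2) ^+ 3.
Proof.
move=> xa yb q0.
apply: cvgM.
  by apply: cvgM => //; apply: cvgD => //; apply: cvgMl_tmp.
apply: cvgV; first by rewrite expf_neq0.
apply: cvg_expX; apply: cvgD; [apply: cvgD|].
- exact: cvg_expX.
- by apply: cvgM => //; apply: cvgMl_tmp.
- by apply: cvgMl_tmp; exact: cvg_expX.
Qed.

(** With [N = n + 2], the point is [N] times [(a, 1 / N)] where [a] tends to 1. Homogeneity gives
    [N ^- 3], the second coordinate gives one more [N^-1], and the rest tends to its value 1 at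
    [(1, 0)]. *)
Lemma green_shape_axis_x {R : realType} (al : R) (k : nat) : 0 < al ->
  (green_shape al (n + k)%:R 1 * (n + 2)%:R ^+ 4) @[n --> \oo] --> (1 : R).
Proof.
move=> al0.
have -> : (fun n => green_shape al (n + k)%:R 1 * (n + 2)%:R ^+ 4) =
   (fun n => let a := (n + k)%:R / (n + 2)%:R in let t := (n + 2)%:R^-1 in
   a * (a + al * t) / (a ^+ 2 + al * a * t + al ^+ 2 * t ^+ 2) ^+ 3).
  apply/funext => n /=.
  have N0 : (n + 2)%:R != 0 :> R by rewrite pnatr_eq0; lia.
  rewrite -[(n + k)%:R in LHS](mulVKf N0) -[X in green_shape _ _ X](mulfV N0).
  rewrite green_shapeZ// [_^-1 * _]mulrC /green_shape.
  move: (n + k)%:R (n + 2)%:R N0 => a N N0.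
  by move: ((_ + _) ^+ 3)^-1 => u; field.
rewrite [X in _ --> X](_ : 1 = 1 * (1 + al * 0) /
    (1 ^+ 2 + al * 1 * 0 + al ^+ 2 * 0 ^+ 2) ^+ 3); last first.
  by rewrite expr0n/= !mulr0 !addr0 !expr1n mulr1 divr1.
apply: cvg_green_form.
- exact: cvg_ratio_natD.
- exact: cvg_inv_natD.
- by rewrite expr0n/= !mulr0 !addr0 expr1n oner_neq0.
Qed.

(** A factor [al] comes out of the numerator and [al ^+ 2] out of the quadratic form, which is
    cubed: the exponent is 1 - 6 = -5. *)
Lemma green_shapeC {R : realType} (al x y : R) : al != 0 ->
  green_shape al x y = green_shape al^-1 y x / al ^+ 5.
Proof.
move=> al0; rewrite /green_shape.
set q := y ^+ 2 + al^-1 * y * x + al^-1 ^+ 2 * x ^+ 2.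
have -> : x ^+ 2 + al * x * y + al ^+ 2 * y ^+ 2 = al ^+ 2 * q.
  by rewrite /q; field.
by rewrite exprMn invfM; move: (q ^+ 3)^-1 => u; field.
Qed.

Lemma green_shape_axis_y {R : realType} (al : R) (k : nat) : 0 < al ->
  (green_shape al 1 (n + k)%:R * (n + 2)%:R ^+ 4) @[n --> \oo] --> al ^- 5.
Proof.
move=> al0.
have -> : (fun n => green_shape al 1 (n + k)%:R * (n + 2)%:R ^+ 4) =
  (fun n => green_shape al^-1 (n + k)%:R 1 * (n + 2)%:R ^+ 4 * al ^- 5).
  by apply/funext => n; rewrite green_shapeC ?gt_eqF// mulrAC.
rewrite -[X in _ --> X]mul1r; apply: cvgMr_tmp.
by apply: green_shape_axis_x; rewrite invr_gt0.
Qed.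

(** * Equivalents of weighted sums *)

(** Divided by its claimed equivalent, [A] is an average, with weights [q k / Q] of sum 1, of
    products of ratios that tend to 1. *)
Lemma asymp_equiv_sum {R : realType} (ks : seq nat) (q : nat -> R)
    (G : nat -> nat -> \bar R) (v : nat -> nat -> R) (A : nat -> \bar R)
    (w : nat -> R) :
  (forall k, 0 <= q k) -> \sum_(k <- ks) q k != 0 ->
  (forall k n, 0 <= G k n)%E -> (forall k n, k \in ks -> 0 < v k n) ->
  (forall n, 0 < w (n + 2)%N) ->
  (forall k, k \in ks -> asymp_equiv (G k) (v k)) ->
  (forall k, k \in ks -> v k n / w (n + 2)%N @[n --> \oo] --> (1 : R)) ->
  (forall n, A (n + 2)%N = \sum_(k <- ks) (q k)%:E * G k n)%E ->
  asymp_equiv A (fun n => (\sum_(k <- ks) q k) * w n).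
Proof.
move=> q0; set Q := \sum_(_ <- _) _ => Q0 G0 v0 w0 Gv vw AE.
have Qgt0 : 0 < Q by rewrite lt_neqAle eq_sym Q0 sumr_ge0.
(* The limit ignores the first terms, and the formula for [A] starts at index 2. *)
rewrite /asymp_equiv -(cvg_shiftn 2).
have -> : (fun n => A (n + 2)%N * ((Q * w (n + 2)%N)^-1)%:E)%E =
  (fun n => \sum_(k <- ks) (q k / Q)%:E *
     (G k n * ((v k n)^-1)%:E * (v k n / w (n + 2)%N)%:E))%E.
  apply/funext => n; rewrite AE muleC ge0_sume_distrr; last first.
    by move=> k _; rewrite mule_ge0// lee_fin.
  apply: eq_big_seq => k kks.
  rewrite -[in RHS]muleA -EFinM mulrA mulVf ?gt_eqF ?v0//.
  rewrite muleA -EFinM muleC [in RHS]muleCA -EFinM; congr (_ * _%:E)%E.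
  by rewrite mul1r invfM mulrC mulrA.
have lim1 : (\sum_(k <- ks) (q k / Q)%:E * (1 * 1) = 1 :> \bar R)%E.
  by under eq_bigr do rewrite !mule1; rewrite sumEFin -mulr_suml mulfV.
suff : (fun n => \sum_(k <- ks) (q k / Q)%:E *
     (G k n * ((v k n)^-1)%:E * (v k n / w (n + 2)%N)%:E))%E @ \oo -->
  (\sum_(k <- ks) (q k / Q)%:E * (1 * 1))%E by rewrite lim1.
rewrite big_seq; under eq_cvg do rewrite big_seq.
apply: cvg_nnesum => k kks.
  apply: nearW => n; rewrite mule_ge0 ?lee_fin ?divr_ge0 ?(ltW Qgt0)//.
  by rewrite !mule_ge0 ?lee_fin ?divr_ge0 ?invr_ge0 ?(ltW (w0 _))
    ?(ltW (v0 _ _ kks)).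
apply: cvgeZl => //; apply: cvgeM => //; first exact: Gv.
by apply: cvg_EFin; [exact: nearW|exact: vw].
Qed.

(** * Green functions and absorption of the walk *)

Section AbsorbedWalk.
Context {R : realType} {d : measure_display} {Omega : measurableType d}.
Variables (P : nat -> nat -> probability Omega R).
Variables (X Y : nat -> {mfun Omega >-> nat}).

Lemma measurable_position n (v : nat * nat) :
  measurable [set w | (X n w, Y n w) = v].
Proof.
case: v => a b.
have -> : [set w | (X n w, Y n w) = (a, b)] =
    X n @^-1` [set a] `&` Y n @^-1` [set b].
  by apply/seteqP; split=> w /= => [[-> ->]|[-> ->]].
by apply: measurableI; rewrite -[_ @^-1` _]setTI; exact: measurable_funP.
Qed.

Lemma green_series i0 j0 i j :
  green P X Y i0 j0 i j =
  (\sum_(0 <= k <oo) P i0 j0 [set w | (X k w, Y k w) = (i, j)])%E.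
Proof.
have mE k := measurable_position k (i, j).
rewrite /green integral_nneseries//; last first.
  by move=> k; apply/measurable_EFinP; exact: measurable_indic.
by apply: eq_eseriesr => k _; rewrite integral_indic// setIT.
Qed.

Lemma green_ge0 i0 j0 i j : (0 <= green P X Y i0 j0 i j)%E.
Proof. by rewrite green_series nneseries_ge0. Qed.

(** A boundary point [b] is absorbing and differs from the interior starting point, so the formula
    for general chains applies. *)
Lemma absorption_from (p : int -> int -> R) i0 j0 (b : nat * nat)
    (s : seq (nat * nat)) :
  (forall r t, 0 <= p r t) -> absorbed_walk p P X Y ->
  (1 <= i0)%N -> (1 <= j0)%N -> ~~ ((0 < b.1) && (0 < b.2))%N ->
  uniq s -> b \notin s ->
  (forall v, v != b -> v \notin s -> absorbing_kernel p v b = 0) ->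
  P i0 j0 [set w | exists2 k, (1 <= k)%N & (X k w, Y k w) = b] =
  (\sum_(v <- s) (absorbing_kernel p v b)%:E * green P X Y i0 j0 v.1 v.2)%E.
Proof.
move=> p0 /(_ i0 j0) walk i0_gt0 j0_gt0 bnd us bs K0.
have [Z0 markov] := walk i0_gt0 j0_gt0.
rewrite (@absorption_green _ _ _ _ (P i0 j0) (fun k w => (X k w, Y k w))
  (absorbing_kernel p) (i0, j0) measurable_position Z0 markov b s) //.
- by apply: eq_bigr => -[x y] _; rewrite green_series.
- by move=> v; rewrite /absorbing_kernel; case: ifP.
- by rewrite /absorbing_kernel (negbTE bnd) eqxx.
- by apply: contra bnd => /eqP <- /=; rewrite i0_gt0.
Qed.

(** * Equivalents along the two axes *)

Section Asymptotics.
Variables (alpha beta C : R) (p : int -> int -> R).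
Hypotheses (alpha_gt0 : 0 < alpha) (hp : classP p).
Hypotheses (hwalk : absorbed_walk p P X Y).
Hypothesis hC : green_constant P X Y alpha beta C.

Variables (i0 j0 : nat).
Hypotheses (hi0 : (1 <= i0)%N) (hj0 : (1 <= j0)%N).

Let H := harm alpha beta i0%:R j0%:R.

Lemma green_axis_x k : (0 < k)%N ->
  asymp_equiv (fun n => green P X Y i0 j0 (n + k) 1)
    (fun n => C * H * green_shape alpha (n + k)%:R 1).
Proof.
move=> k0; have pi0 := @pi_gt0 R.
have g : 0 <= (0 : R) <= pi / 2 by rewrite lexx divr_ge0 ?ltW.
have along : to_infinity_along (0 : R) (fun n => (n + k)%N) (fun=> 1%N).
  split=> [n|| ]; first lia.
    by apply/cvgnyPge => A; exists A => // n /=; lia.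
  rewrite /tan_bar lt_eqF ?divr_gt0// tan0.
  apply: cvg_EFin; first exact: nearW.
  by under eq_cvg do rewrite /= mul1r; exact: cvg_inv_natD.
have := hC _ _ hi0 hj0 _ g _ _ along.
by rewrite /asymp_equiv /=; under eq_cvg do rewrite -mulrA.
Qed.

Lemma green_axis_y k : (0 < k)%N ->
  asymp_equiv (fun n => green P X Y i0 j0 1 (n + k))
    (fun n => C * H * green_shape alpha 1 (n + k)%:R).
Proof.
move=> k0; have pi0 := @pi_gt0 R.
have g : 0 <= (pi / 2 : R) <= pi / 2 by rewrite lexx divr_ge0 ?ltW.
have along : to_infinity_along (pi / 2 : R) (fun=> 1%N) (fun n => (n + k)%N).
  split=> [n|| ]; first lia.
    by apply/cvgnyPge => A; exists A => // n /=; lia.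
  rewrite /tan_bar eqxx; apply/cvgeryP.
  under eq_cvg do rewrite divr1.
  by apply/cvgrnyP/cvgnyPge => A; exists A => // n /=; lia.
have := hC _ _ hi0 hj0 _ g _ _ along.
by rewrite /asymp_equiv /=; under eq_cvg do rewrite -mulrA.
Qed.

(* A nonpositive constant would give Green functions of the wrong sign. *)
Lemma green_coeff_gt0 : 0 < C * H.
Proof.
rewrite ltNge; apply/negP => H0.
suff : (1 <= 0 :> \bar R)%E by rewrite leNgt lte01.
have lim1 := @green_axis_x 1 isT; apply: (cvge_to_le lim1).
(* This covers [C * H = 0] too: the inverse of 0 is 0, so the quotient is still nonpositive. *)
apply: nearW => n; rewrite mule_ge0_le0 ?green_ge0// lee_fin invr_le0.
rewrite mulr_le0_ge0// ltW// green_shape_gt0// ltr0n; lia.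
Qed.

(* The summand k is the jump with vertical part -1 and horizontal part 2 - k;
   the offset 2 keeps the predecessors (n + k, 1) in the interior. *)
Lemma absorb_x_green n : absorb_x P X Y i0 j0 (n + 2) =
  (\sum_(k <- [:: 1; 2; 3]%N)
     (p (2%:Z - k%:Z) (-1))%:E * green P X Y i0 j0 (n + k) 1)%E.
Proof.
have [psupp p0 _ _ _ _ _ _] := hp.
rewrite /absorb_x (@absorption_from p i0 j0 ((n + 2)%N, 0%N)
  [seq ((n + k)%N, 1%N) | k <- [:: 1; 2; 3]%N])//; last first.
(* An interior state off the list is more than one unit away from the target in some coordinate; a
   boundary state other than the target stays put. *)
- move=> [x y]; rewrite /absorbing_kernel !inE !xpair_eqE /=.
  case: ifP => [xy_gt0 _ h|_ /negbTE]; last first.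
    by rewrite eq_sym [_ == y]eq_sym => ->.
  by apply: psupp; rewrite !inE; lia.
- rewrite !inE !xpair_eqE /=; lia.
- by rewrite map_inj_uniq// => k l [] /addnI.
- by rewrite /= andbF.
rewrite big_map; apply: eq_big_seq => k; rewrite !inE => hk.
rewrite /absorbing_kernel ifT /=; last lia.
by rewrite (_ : (n + 2)%:Z - (n + k)%:Z = 2%:Z - k%:Z) //; lia.
Qed.

(** Mirror image: the summand [k] is the jump with horizontal part -1 and vertical part [2 - k]. *)
Lemma absorb_y_green n : absorb_y P X Y i0 j0 (n + 2) =
  (\sum_(k <- [:: 1; 2; 3]%N)
     (p (-1) (2%:Z - k%:Z))%:E * green P X Y i0 j0 1 (n + k))%E.
Proof.
have [psupp p0 _ _ _ _ _ _] := hp.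
rewrite /absorb_y (@absorption_from p i0 j0 (0%N, (n + 2)%N)
  [seq (1%N, (n + k)%N) | k <- [:: 1; 2; 3]%N])//; last first.
- move=> [x y]; rewrite /absorbing_kernel !inE !xpair_eqE /=.
  case: ifP => [xy_gt0 _ h|_ /negbTE]; last first.
    by rewrite eq_sym [_ == y]eq_sym => ->.
  by apply: psupp; rewrite !inE; lia.
- by rewrite map_inj_uniq// => k l [] /addnI.
rewrite big_map; apply: eq_big_seq => k; rewrite !inE => hk.
rewrite /absorbing_kernel ifT /=; last lia.
by rewrite (_ : (n + 2)%:Z - (n + k)%:Z = 2%:Z - k%:Z) //; lia.
Qed.

Let sum_steps (f : int -> R) :
  \sum_(k <- [:: 1; 2; 3]%N) f (2%:Z - k%:Z) = f 1 + f 0 + f (-1).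
Proof. by rewrite !big_cons big_nil addr0 addrA. Qed.

Lemma absorb_x_asymp :
  asymp_equiv (absorb_x P X Y i0 j0)
    (fun i => (p 1 (-1) + p 0 (-1) + p (-1) (-1)) * (C * H / i%:R ^+ 4)).
Proof.
have [_ p0 _ _ _ _ _ _] := hp; have CH := green_coeff_gt0.
rewrite -(sum_steps (p ^~ (-1))).
apply: (@asymp_equiv_sum _ _ _ (fun k n => green P X Y i0 j0 (n + k) 1)
  (fun k n => C * H * green_shape alpha (n + k)%:R 1)) => //.
- by rewrite (sum_steps (p ^~ (-1))) gt_eqF// down_gt0.
- by move=> k n; exact: green_ge0.
- move=> k n; rewrite !inE => hk.
  by rewrite mulr_gt0// green_shape_gt0// ltr0n; lia.
- by move=> n; rewrite divr_gt0// exprn_gt0// ltr0n; lia.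
- by move=> k; rewrite !inE => hk; apply: green_axis_x; lia.
(* The nonzero constant [C * H] cancels in the ratio. *)
- move=> k _; rewrite (_ : (fun n => _) =
    fun n => green_shape alpha (n + k)%:R 1 * (n + 2)%:R ^+ 4).
    exact: green_shape_axis_x.
  apply/funext => n; have N0 : (n + 2)%:R != 0 :> R by rewrite pnatr_eq0; lia.
  move: (C * H) (lt0r_neq0 CH) (green_shape _ _ _) (n + 2)%:R N0 => c c0 g N N0.
  by field; rewrite c0 N0.
- exact: absorb_x_green.
Qed.

Lemma absorb_y_asymp :
  asymp_equiv (absorb_y P X Y i0 j0) (fun i =>
    (p (-1) 1 + p (-1) 0 + p (-1) (-1)) * (C * H / alpha ^+ 5 / i%:R ^+ 4)).
Proof.
have [_ p0 _ _ _ _ _ _] := hp; have CH := green_coeff_gt0.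
rewrite -(sum_steps (p (-1))).
apply: (@asymp_equiv_sum _ _ _ (fun k n => green P X Y i0 j0 1 (n + k))
  (fun k n => C * H * green_shape alpha 1 (n + k)%:R)) => //.
- by rewrite (sum_steps (p (-1))) gt_eqF// left_gt0.
- by move=> k n; exact: green_ge0.
- move=> k n; rewrite !inE => hk.
  by rewrite mulr_gt0// green_shape_gt0// ltr0n; lia.
- by move=> n; rewrite !divr_gt0 ?exprn_gt0// ltr0n; lia.
- by move=> k; rewrite !inE => hk; apply: green_axis_y; lia.
(* On this axis the rescaled function tends to [alpha ^- 5]; the factor [alpha ^+ 5] of the
   reference sequence brings the limit back to 1. *)
- move=> k _; rewrite (_ : (fun n => _) =
    fun n => green_shape alpha 1 (n + k)%:R * (n + 2)%:R ^+ 4 * alpha ^+ 5).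
    rewrite [X in _ --> X](_ : 1 = alpha ^- 5 * alpha ^+ 5).
      by apply: cvgMr_tmp; exact: green_shape_axis_y.
    by rewrite mulVf// expf_neq0// gt_eqF.
  apply/funext => n; have N0 : (n + 2)%:R != 0 :> R by rewrite pnatr_eq0; lia.
  have a0 := lt0r_neq0 alpha_gt0.
  move: (C * H) (lt0r_neq0 CH) (green_shape _ _ _) (n + 2)%:R N0 => c c0 g N N0.
  by field; rewrite a0 c0 N0.
- exact: absorb_y_green.
Qed.

End Asymptotics.
End AbsorbedWalk.

Theorem corollary3 (R : realType) (alpha beta : R) (p : int -> int -> R) (C : R)
    (d : measure_display) (Omega : measurableType d)
    (P : nat -> nat -> probability Omega R)
    (X Y : nat -> {mfun Omega >-> nat})
    (halpha : 1 / 2 <= alpha <= 2)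
    (hp : classPab p alpha beta)
    (hwalk : absorbed_walk p P X Y)
    (hC0 : 0 < C)
    (hC : green_constant P X Y alpha beta C)
    (i0 j0 : nat) (hi0 : (1 <= i0)%N) (hj0 : (1 <= j0)%N) :
  asymp_equiv (fun i : nat => absorb_x P X Y i0 j0 i)
    (fun i : nat => C * (p 1 (-1) + p 0 (-1) + p (-1) (-1))
       * (i0%:R * j0%:R * (i0%:R + alpha * j0%:R + beta)) * (1 / i%:R ^+ 4)) /\
  asymp_equiv (fun i : nat => absorb_y P X Y i0 j0 i)
    (fun i : nat => C * ((p (-1) 1 + p (-1) 0 + p (-1) (-1)) / alpha ^+ 5)
       * (i0%:R * j0%:R * (i0%:R + alpha * j0%:R + beta)) * (1 / i%:R ^+ 4)).
Proof.
have [hpP _] := hp; have alpha_gt0 : 0 < alpha by case/andP: halpha; lra.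
split.
- rewrite (_ : (fun i : nat => _) = fun i =>
    (p 1 (-1) + p 0 (-1) + p (-1) (-1)) *
    (C * harm alpha beta i0%:R j0%:R / i%:R ^+ 4)).
    exact: absorb_x_asymp.
  by apply/funext => i; rewrite /harm div1r; ring.
- rewrite (_ : (fun i : nat => _) = fun i =>
    (p (-1) 1 + p (-1) 0 + p (-1) (-1)) *
    (C * harm alpha beta i0%:R j0%:R / alpha ^+ 5 / i%:R ^+ 4)).
    exact: absorb_y_asymp.
  by apply/funext => i; rewrite /harm div1r; ring.
Qed.
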